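(* There exists no randomized online algorithm that achieves a finite competitive ratio against an oblivious adversary for the $3$-MPMD problem on any $2$-metric with at least $3$ points.
   Context: The $k$-MPMD problem: a finite generalized metric space $(V,d)$ with $|V|=n$ and $d:V^k\to[0,\infty)$ is given. Requests arrive online; each request $\rho$ has a location $\ell(\rho)\in V$ and an arrival time $t(\rho)\ge 0$, and becomes known to the algorithm at time $t(\rho)$. The algorithm must irrevocably partition the request sequence $R$ (whose size is a multiple of $k$) into sets of exactly $k$ requests; a set can be formed at any time after all its members have arrived. Matching the set $\{\rho_1,\dots,\rho_k\}$ incurs space cost $d(\ell(\rho_1),\dots,\ell(\rho_k))$, and a request $\rho$ matched at time $t'(\rho)$ incurs time cost $t'(\rho)-t(\rho)$. The total cost $\mathrm{cost}_{\mathcal{ALG}}(R)$ is the sum of all space and time costs; $\mathrm{cost}_{\mathcal{OPT}}(R)$ is the optimal offline cost. The competitive ratio of a randomized algorithm $\mathcal{ALG}$ is $\sup_R \mathbb{E}[\mathrm{cost}_{\mathcal{ALG}}(R)]/\mathrm{cost}_{\mathcal{OPT}}(R)$, where the (oblivious) adversary fixes $R$ without seeing the algorithm's random choices. A $2$-metric on $V$ is a function $d:V^3\to[0,\infty)$ such that for all $v_1,v_2,v_3,a\in V$: ($\Pi$) $d(v_1,v_2,v_3)$ is invariant under permutations of its arguments; ($O_2$) $d(v_1,v_2,v_3)=0$ if and only if at least two of $v_1,v_2,v_3$ are equal, and $d(v_1,v_2,v_3)>0$ otherwise; ($\Delta_D$) $d(v_1,v_2,v_3)\le d(v_1,v_2,a)+d(v_1,a,v_3)+d(a,v_2,v_3)$.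 *)

(* Defs.v *)
From HB Require Import structures.
From mathcomp Require Import all_boot all_order all_algebra.
From mathcomp Require Import finmap.
From mathcomp Require Import all_classical all_reals all_analysis.

Set Implicit Arguments.
Unset Strict Implicit.
Unset Printing Implicit Defensive.

Import Order.TTheory GRing.Theory Num.Theory.

Local Open Scope classical_set_scope.
Local Open Scope ring_scope.

Section TwoMetric.
Context {R : realType} {V : finType}.

Definition two_metric (d : 3.-tuple V -> R) : Prop :=
  [/\ forall x, 0 <= d x,
      forall x y : 3.-tuple V, perm_eq x y -> d x = d y,
      forall v1 v2 v3, d [tuple v1; v2; v3] = 0 <-> [\/ v1 = v2, v1 = v3 | v2 = v3],
      forall v1 v2 v3, ~ [\/ v1 = v2, v1 = v3 | v2 = v3] -> 0 < d [tuple v1; v2; v3] &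
      forall v1 v2 v3 a,
        d [tuple v1; v2; v3] <=
          d [tuple v1; v2; a] + d [tuple v1; a; v3] + d [tuple a; v2; v3]].

End TwoMetric.

Section MPMD.
Context {R : realType} {V : finType}.

Record request := Request { loc : V ; arr : R }.

(* Requests are listed in order of arrival (ties in any order) and are named by
   their position, so those arrived by a given time form a prefix. *)
Definition instance (k : nat) : set (seq request) :=
  [set r | [/\ all (fun q => 0 <= arr q) r,
               sorted (fun q q' => arr q <= arr q') r & (k %| size r)%N]].

(* A solution is the finite set of its matching events (B, t): the requests
   with positions in B are matched together at time t. *)
Definition solution := {fset ({fset nat} * R)%type}.

Definition members (r : seq request) (B : {fset nat}) : seq request :=
  mask [seq i \in B | i <- iota 0 (size r)] r.

Definition feasible (k : nat) (r : seq request) : set solution :=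
  [set S : solution | [/\ forall m, m \in S -> #|` m.1| = k,
               forall m i, m \in S -> i \in m.1 -> (i < size r)%N,
               forall i, (i < size r)%N -> exists! m, m \in S /\ i \in m.1 &
               forall m, m \in S -> all (fun q => arr q <= m.2) (members r m.1)]].

(* In a feasible solution the list of locations has length k, so that the
   default value 0 is never used. *)
Definition space_cost (k : nat) (d : k.-tuple V -> R) (r : seq request)
    (B : {fset nat}) : R :=
  oapp d 0 (insub (map loc (members r B))).

Definition time_cost (r : seq request) (m : {fset nat} * R) : R :=
  \sum_(q <- members r m.1) (m.2 - arr q).

Definition cost (k : nat) (d : k.-tuple V -> R) (r : seq request)
    (S : solution) : R :=
  \sum_(m <- S) (space_cost d r m.1 + time_cost r m).

Definition cost_opt (k : nat) (d : k.-tuple V -> R) (r : seq request) : \bar R :=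
  ereal_inf [set (cost d r S)%:E | S in feasible k r].

Definition arrived (r : seq request) (t : R) : seq request :=
  [seq q <- r | arr q <= t].

Definition executed (S : solution) (t : R) : solution :=
  [fset m in S | m.2 <= t]%fset.

(* The second clause says both that decisions taken by time t depend only on
   the requests known at time t, and that they are irrevocable. *)
Definition online_algorithm (k : nat) (A : seq request -> solution) : Prop :=
  (forall r, instance k r -> feasible k r (A r)) /\
  (forall r r' t, instance k r -> instance k r' ->
     arrived r t = arrived r' t -> executed (A r) t = executed (A r') t).

(* Random choices are drawn from a sample space, independently of the input:
   each outcome w yields a deterministic online algorithm A w.  Measurability
   is only required of the cost, the weakest condition for the expected cost
   to make sense. *)
Definition randomized_online_algorithm (k : nat) (d : k.-tuple V -> R)
    (disp : measure_display) (Omega : measurableType disp)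
    (A : Omega -> seq request -> solution) : Prop :=
  (forall w, online_algorithm k (A w)) /\
  (forall r, instance k r -> measurable_fun setT (fun w => cost d r (A w r))).

Definition expected_cost (k : nat) (d : k.-tuple V -> R)
    (disp : measure_display) (Omega : measurableType disp)
    (P : probability Omega R) (A : Omega -> seq request -> solution)
    (r : seq request) : \bar R :=
  'E_P[fun w => cost d r (A w r)]%E.

(* Division in \bar R satisfies x / 0 = +oo for 0 < x, and 0 / 0 = 0. *)
Definition competitive_ratio (k : nat) (d : k.-tuple V -> R)
    (disp : measure_display) (Omega : measurableType disp)
    (P : probability Omega R) (A : Omega -> seq request -> solution) : \bar R :=
  ereal_sup [set (expected_cost d P A r / cost_opt d r)%E | r in instance k].

End MPMD.

Arguments request : clear implicits.
Arguments solution : clear implicits.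

(* Main.v *)
(** Let a, b, c be distinct points.  The instance with requests a, a, b at time 0
    has optimal cost 0, so a competitive algorithm almost surely matches these
    three requests together at time 0.  If requests a, b, c then arrive at time
    e > 0, the algorithm must also match those three together and pays
    d(a, b, c) > 0, whereas forming {a, a, a} and {b, b, c} at time e costs only
    the waiting time 3e.  Let e tend to 0. *)
Require Import Defs.
From HB Require Import structures.
From mathcomp Require Import all_boot all_order all_algebra.
From mathcomp Require Import finmap.
From mathcomp Require Import all_classical all_reals all_analysis.
From mathcomp Require Import measurable_realfun ring lra.

Set Implicit Arguments.
Unset Strict Implicit.
Unset Printing Implicit Defensive.

Import Order.TTheory GRing.Theory Num.Theory.

Local Open Scope classical_set_scope.
Local Open Scope ring_scope.

(** A duplicate-free list of length [k] inside a list of length [k] has the same elements. This pins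
    down an event that can only use [k] consecutive positions. *)
Lemma fset_eqi_iota (B : {fset nat}) (p k : nat) :
  #|` B| = k -> (forall i, i \in B -> (p <= i < p + k)%N) -> B =i iota p k.
Proof.
move=> cardB Bpk.
have [] // := @uniq_min_size _ (enum_fset B) (iota p k) (fset_uniq B).
- by move=> i /Bpk; rewrite mem_iota.
- by rewrite size_iota -cardB.
Qed.

(** * Costs of feasible solutions *)

Section Costs.
Context {R : realType} {V : finType}.
Implicit Types (r : seq (request R V)) (S : solution R).

(** With an explicit list [s] in place of the finite set, the mask reduces by computation. *)
Lemma members_eqi r (B : {fset nat}) (s : seq nat) : B =i s ->
  members r B = mask [seq i \in s | i <- iota 0 (size r)] r.
Proof. by move=> Bs; congr mask; apply: eq_map. Qed.

Lemma space_cost_ge0 k (d : k.-tuple V -> R) r B :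
  (forall x, 0 <= d x) -> 0 <= space_cost d r B.
Proof. by move=> d_ge0; rewrite /space_cost; case: insub => //=. Qed.

Lemma time_cost_ge0 k r S m : feasible k r S -> m \in S -> 0 <= time_cost r m.
Proof.
case=> _ _ _ Sarr /Sarr; rewrite /time_cost.
elim: (members r m.1) => [|q s IHs] /=; first by rewrite big_nil.
by case/andP=> arr_q /IHs sum_ge0; rewrite big_cons addr_ge0 ?subr_ge0.
Qed.

Lemma cost_ge0 k (d : k.-tuple V -> R) r S :
  (forall x, 0 <= d x) -> feasible k r S -> 0 <= cost d r S.
Proof.
move=> d_ge0 feasS; rewrite /cost big_seq; apply: sumr_ge0 => m mS.
by rewrite addr_ge0 ?space_cost_ge0// (time_cost_ge0 feasS).
Qed.

Lemma cost_opt_ge0 k (d : k.-tuple V -> R) r :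
  (forall x, 0 <= d x) -> (0 <= cost_opt d r)%E.
Proof.
move=> d_ge0; apply: le_ereal_inf_tmp => _ [S feasS <-].
by rewrite lee_fin cost_ge0.
Qed.

Lemma cost_opt_le k (d : k.-tuple V -> R) r S :
  feasible k r S -> (cost_opt d r <= (cost d r S)%:E)%E.
Proof. by move=> feasS; apply: ereal_inf_lbound; exists S. Qed.

(** The other events contribute nonnegative amounts. *)
Lemma event_cost_le k (d : k.-tuple V -> R) r S m :
  (forall x, 0 <= d x) -> feasible k r S -> m \in S ->
  space_cost d r m.1 + time_cost r m <= cost d r S.
Proof.
move=> d_ge0 feasS mS; rewrite /cost (big_fsetD1 m)//= lerDl big_seq.
apply: sumr_ge0 => m'; rewrite in_fsetD1 => /andP[_ m'S].
by rewrite addr_ge0 ?space_cost_ge0// (time_cost_ge0 feasS).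
Qed.

Lemma space_cost_tuple k (d : k.-tuple V -> R) r B (t : k.-tuple V) :
  map (@loc R V) (members r B) = t -> space_cost d r B = d t.
Proof. by move=> Bt; rewrite /space_cost Bt valK. Qed.

End Costs.

(** * The adversarial instances *)

Section Adversary.
Context {R : realType} {V : finType}.
Variable d : 3.-tuple V -> R.
Hypothesis d_2metric : two_metric d.
Variables a b c : V.

Definition first_batch : seq (request R V) :=
  [:: Request a 0; Request a 0; Request b 0].

Definition two_batches (e : R) : seq (request R V) :=
  first_batch ++ [:: Request a e; Request b e; Request c e].

Lemma instance_first_batch : instance 3 first_batch.
Proof. by split => //=; rewrite lexx. Qed.

Lemma instance_two_batches e : 0 <= e -> instance 3 (two_batches e).
Proof. by move=> e_ge0; split => //=; rewrite !lexx !e_ge0. Qed.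

(** Since [e] is strictly positive, the second batch is still invisible at time 0. *)
Lemma arrived_two_batches e : 0 < e ->
  arrived first_batch 0 = arrived (two_batches e) 0.
Proof. by move=> e_gt0; rewrite /arrived /= lexx leNgt e_gt0. Qed.

Let d_ge0 x : 0 <= d x. Proof. by case: d_2metric. Qed.

Let d_aab (u v : V) : d [tuple u; u; v] = 0.
Proof. by case: d_2metric => _ _ d0 _ _; apply/d0; constructor. Qed.

Lemma cost_opt_first_batch : cost_opt d first_batch = 0%E.
Proof.
apply/eqP; rewrite eq_le cost_opt_ge0// andbT.
pose B : {fset nat} := [fset i in iota 0 3]%fset.
have Bs : B =i iota 0 3 by move=> i; rewrite in_fset.
have feasS : feasible 3 first_batch [fset (B, 0 : R)]%fset.
  split => [m|m i|i|m].
  - by rewrite inE => /eqP->; rewrite card_fseq.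
  - by rewrite inE => /eqP->; rewrite Bs mem_iota.
  - move=> i3; exists (B, 0); split=> [|m []]; last by rewrite inE => /eqP->.
    by rewrite inE eqxx Bs mem_iota.
  - by rewrite inE => /eqP->; rewrite (members_eqi _ Bs)/= lexx.
apply: le_trans (cost_opt_le d feasS) _.
rewrite lee_fin /cost big_seq_fset1 (space_cost_tuple _ (t := [tuple a; a; b])).
  by rewrite d_aab /time_cost (members_eqi _ Bs)/= !big_cons big_nil/= subr0 !addr0.
by rewrite (members_eqi _ Bs).
Qed.

(** With only three requests, the event of position 0 takes them all. Its waiting cost is [3 * m.2]
    and its space cost is nonnegative, so zero total cost forces [m.2 <= 0]. *)
Lemma first_batch_matched_at_0 S :
  feasible 3 first_batch S -> cost d first_batch S = 0 ->
  exists2 m, m \in executed S 0 & m.1 =i iota 0 3.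
Proof.
move=> feasS cost0; have [Scard Slt Sex _] := feasS.
have [m [[mS m0] _]] := Sex 0%N isT.
have ms : m.1 =i iota 0 3.
  by apply: fset_eqi_iota => [|i im]; [exact: Scard | exact: (Slt m)].
exists m => //; rewrite !inE mS /=.
have := event_cost_le d_ge0 feasS mS; rewrite cost0.
have := space_cost_ge0 first_batch m.1 d_ge0.
rewrite /time_cost (members_eqi _ ms)/= !big_cons big_nil/=; lra.
Qed.

Lemma cost_two_batches_ge e S m :
  feasible 3 (two_batches e) S -> m \in S -> m.1 =i iota 0 3 ->
  d [tuple a; b; c] <= cost d (two_batches e) S.
Proof.
move=> feasS mS ms; have [Scard Slt Sex _] := feasS.
have [m' [[m'S m'3] _]] := Sex 3%N isT.
have m's : m'.1 =i iota 3 3.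
  apply: fset_eqi_iota => [|i im']; first exact: Scard.
  rewrite (Slt m' i)// andbT leqNgt; apply/negP => i3.
  have [m'' [_ m''_uniq]] := Sex i (Slt _ _ m'S im').
  (* A position below 3 in [m'] would lie in both events, making them equal, yet position 3 is not
     in [m]. *)
  have im : i \in m.1 by rewrite ms mem_iota.
  move: m'3; rewrite -(m''_uniq m' (conj m'S im')) (m''_uniq m (conj mS im)).
  by rewrite ms.
apply: le_trans (event_cost_le d_ge0 feasS m'S).
rewrite (space_cost_tuple _ (t := [tuple a; b; c])).
  by rewrite lerDl (time_cost_ge0 feasS).
by rewrite (members_eqi _ m's).
Qed.

Lemma cost_opt_two_batches e : 0 <= e ->
  (cost_opt d (two_batches e) <= (3 * e)%:E)%E.
Proof.
move=> e_ge0.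
(* These positions carry the locations a, a, a and b, b, c. Matched at time [e], only positions 0, 1
   and 2 wait, each for [e]. *)
pose s1 := [:: 0; 1; 3]%N; pose s2 := [:: 2; 4; 5]%N.
pose B1 : {fset nat} := [fset i in s1]%fset.
pose B2 : {fset nat} := [fset i in s2]%fset.
have Bs1 : B1 =i s1 by move=> i; rewrite in_fset.
have Bs2 : B2 =i s2 by move=> i; rewrite in_fset.
have s2E i : (i < 6)%N -> (i \in s2) = (i \notin s1) by do 6?case: i => [|i].
have B12 : (B1, e) != (B2, e).
  by apply/eqP => -[] /fsetP/(_ 0%N); rewrite Bs1 Bs2.
have feasS : feasible 3 (two_batches e) [fset (B1, e); (B2, e)]%fset.
  split => [m|m i|i|m].
  - by rewrite in_fset2 => /orP[] /eqP->; rewrite card_fseq.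
  - rewrite in_fset2 => /orP[] /eqP->; rewrite ?Bs1 ?Bs2;
      by move: i; apply/allP.
  - move=> i6; have [is1|is1] := boolP (i \in s1).
      exists (B1, e); split=> [|m []]; first by rewrite in_fset2 eqxx Bs1.
      rewrite in_fset2 => /orP[] /eqP-> //; by rewrite Bs2 s2E// is1.
    exists (B2, e); split=> [|m []]; first by rewrite in_fset2 eqxx orbT Bs2 s2E.
    by rewrite in_fset2 => /orP[] /eqP-> //; rewrite Bs1 (negPf is1).
  - rewrite in_fset2 => /orP[] /eqP->.
      by rewrite (members_eqi _ Bs1)/= !lexx !e_ge0.
    by rewrite (members_eqi _ Bs2)/= !lexx !e_ge0.
apply: le_trans (cost_opt_le d feasS) _.
rewrite lee_fin /cost big_fsetU1 ?inE//= big_seq_fset1.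
rewrite (space_cost_tuple _ (t := [tuple a; a; a])); last by rewrite (members_eqi _ Bs1).
rewrite (space_cost_tuple _ (t := [tuple b; b; c])); last by rewrite (members_eqi _ Bs2).
rewrite !d_aab /time_cost (members_eqi _ Bs1) (members_eqi _ Bs2)/=.
rewrite !big_cons !big_nil/=; lra.
Qed.

(** * Consequences of a finite competitive ratio *)

Section Competitive.
Variables (disp : measure_display) (Omega : measurableType disp).
Variables (P : probability Omega R) (A : Omega -> seq (request R V) -> solution R).
Hypothesis online_A : randomized_online_algorithm d A.
Hypothesis ratio_A : (competitive_ratio d P A < +oo)%E.

Let A_feasible w r : instance 3 r -> feasible 3 r (A w r).
Proof. by case: online_A => /(_ w)[+ _] _; apply. Qed.

Let A_cost_ge0 w r : instance 3 r -> 0 <= cost d r (A w r).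
Proof. by move=> inst_r; rewrite cost_ge0//; exact: A_feasible. Qed.

Let ratio_ge r : instance 3 r ->
  (expected_cost d P A r / cost_opt d r <= competitive_ratio d P A)%E.
Proof. by move=> inst_r; apply: ereal_sup_ubound; exists r. Qed.

Lemma expected_cost_first_batch : expected_cost d P A first_batch = 0%E.
Proof.
have E_ge0 : (0 <= expected_cost d P A first_batch)%E.
  by apply: expectation_ge0 => w; apply: A_cost_ge0; exact: instance_first_batch.
apply/eqP; rewrite eq_le E_ge0 andbT leNgt; apply/negP => E_gt0.
(* The optimum is 0, so a positive expectation would give the ratio [+oo]. *)
have := ratio_ge instance_first_batch.
by rewrite cost_opt_first_batch inve0 gt0_muley// leNgt ratio_A.
Qed.

(** A nonnegative measurable function with zero integral vanishes almost everywhere. *)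
Lemma ae_cost_first_batch_eq0 :
  {ae P, forall w, cost d first_batch (A w first_batch) = 0}.
Proof.
have [_ /(_ _ instance_first_batch) mcost] := online_A.
have /measurable_EFinP/(ae_eq_integral_abs P measurableT)[+ _] := mcost.
case=> [|N [mN PN0 subN]].
  rewrite -[RHS]expected_cost_first_batch /expected_cost unlock.
  apply: eq_integral => w _; rewrite gee0_abs// lee_fin A_cost_ge0//.
  exact: instance_first_batch.
exists N; split=> // w /= cost_neq0; apply: subN => /= cost_eq0.
by apply: cost_neq0; apply: EFin_inj; exact: cost_eq0.
Qed.

Lemma expected_cost_two_batches_ge e : 0 < e ->
  ((d [tuple a; b; c])%:E <= expected_cost d P A (two_batches e))%E.
Proof.
move=> e_gt0; have inst_e := instance_two_batches (ltW e_gt0).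
have [A_online /(_ _ inst_e) mcost] := online_A.
rewrite -[leLHS](expectation_cst P); apply: expectation_le => //.
- by move=> w; exact: d_ge0.
- by move=> w; exact: A_cost_ge0.
- apply: filterS ae_cost_first_batch_eq0 => w cost0.
  have [|m mS ms] := first_batch_matched_at_0 _ cost0.
    exact/A_feasible/instance_first_batch.
  apply: (@cost_two_batches_ge _ _ m) => //; first exact: A_feasible.
  (* Both inputs look alike at time 0, so the event executed by then on the first batch also occurs
     on the longer input. *)
  move: mS; have [_ nonantic] := A_online w.
  rewrite (nonantic _ _ _ instance_first_batch inst_e (arrived_two_batches e_gt0)).
  by rewrite !inE => /andP[].
Qed.

Lemma ratio_two_batches_ge e : 0 < e ->
  ((d [tuple a; b; c] / (3 * e))%:E <= competitive_ratio d P A)%E.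
Proof.
move=> e_gt0; have inst_e := instance_two_batches (ltW e_gt0).
apply: le_trans (ratio_ge inst_e).
have e3_gt0 : 0 < 3 * e by rewrite mulr_gt0.
have -> : ((d [tuple a; b; c] / (3 * e))%:E =
    (d [tuple a; b; c])%:E / (3 * e)%:E)%E.
  by rewrite inver (gt_eqF e3_gt0) EFinM.
apply: lee_pmul => //.
- by rewrite lee_fin.
- by rewrite inve_ge0 lee_fin ltW.
- exact: expected_cost_two_batches_ge.
(* Inversion is antitone on nonnegative extended reals, so the upper bound on the optimum
   suffices. *)
- rewrite lee_pV2 ?inE ?cost_opt_ge0// ?lee_fin ?(ltW e3_gt0)//.
  exact/cost_opt_two_batches/ltW.
Qed.

Lemma distance_eq0_of_competitive : d [tuple a; b; c] = 0.
Proof.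
apply/eqP; rewrite eq_le d_ge0 andbT leNgt; apply/negP => D_gt0.
(* The bound at [e = 1] rules out the ratio [-oo] and shows that a finite ratio [x] is
   nonnegative. *)
have := ratio_two_batches_ge ltr01; have := ratio_two_batches_ge.
move: ratio_A; case: (competitive_ratio d P A) => [x| |]// _ x_ge.
set D := d _ in D_gt0 x_ge *; rewrite lee_fin mulr1 => Dx.
have x_gt0 : 0 < x + 1 by apply: ltr_pwDr => //; apply: le_trans Dx; rewrite divr_ge0 ?ltW.
(* This value of [e] makes the lower bound equal to [x + 1], which exceeds the ratio [x]. *)
have /x_ge : 0 < D / (3 * (x + 1)) by rewrite divr_gt0// mulr_gt0.
rewrite lee_fin.
have -> : D / (3 * (D / (3 * (x + 1)))) = x + 1.
  by field; rewrite !gt_eqF.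
by rewrite gerDl ler10.
Qed.

End Competitive.

End Adversary.

Theorem theorem1 (R : realType) (V : finType) (d : 3.-tuple V -> R)
    (card_V : (3 <= #|V|)%N) (d_2metric : two_metric d) :
  ~ exists (disp : measure_display) (Omega : measurableType disp)
      (P : probability Omega R)
      (A : Omega -> seq (request R V) -> solution R),
      randomized_online_algorithm d A /\ (competitive_ratio d P A < +oo)%E.
Proof.
case=> disp [T [P [A [online_A ratio_A]]]].
have /card_gt2P[a [b [c [_ [ab bc ca]]]]] := card_V.
have := distance_eq0_of_competitive d_2metric a b c online_A ratio_A.
(* Zero distance would make two of the three distinct points coincide. *)
case: d_2metric => _ _ d0 _ _ /d0[] /eqP; rewrite ?(negPf ab) ?(negPf bc)//.
by rewrite eq_sym (negPf ca).
Qed.
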